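(* There exists an introenumerable set which is not uniformly introenumerable, not introreducible, and not majorenumerable.
   Context: An enumeration operator $\Theta$ is a c.e. set of pairs $\langle u,n\rangle$, with $\Theta(X)=\{n:\exists u\,(D_u\subseteq X\wedge\langle u,n\rangle\in\Theta)\}$; $A\le_e X$ if $A=\Theta(X)$ for some enumeration operator. An infinite set $A$ is introenumerable if $A\le_e C$ for every infinite $C\subseteq A$; uniformly introenumerable if a single enumeration operator $\Theta$ has $\Theta(C)=A$ for every infinite $C\subseteq A$; introreducible if $A\le_T C$ for every infinite $C\subseteq A$; majorenumerable if $A\le_e\mathrm{graph}(f)$ for every function $f$ with $f(n)\ge p_A(n)$ for all $n$, where $p_A(n)$ is the $n$-th element of $A$ in increasing order. *)

(* Defs.v *)
From Stdlib Require Cantor.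
From mathcomp Require Import all_boot.
From mathcomp Require Import boolp classical_sets cardinality.

Set Implicit Arguments.
Unset Strict Implicit.
Unset Printing Implicit Defensive.

Local Open Scope classical_set_scope.

(** Partial recursive functions with a set oracle, presented as unary functions
    over a pairing function: the closure of zero, successor, the two
    projections and the oracle under pairing, composition, primitive recursion
    and unbounded search. *)

Definition npair (m n : nat) : nat := Cantor.to_nat (m, n).
Definition nfst (x : nat) : nat := (Cantor.of_nat x).1.
Definition nsnd (x : nat) : nat := (Cantor.of_nat x).2.

Inductive code : Type :=
| CZero | CSucc | CFst | CSnd | COracle
| CPair of code & code
| CComp of code & code
| CRec of code & code
| CMu of code.

(* The graph of h(a, 0) = f(a), h(a, m+1) = g(a, m, h(a, m)). *)
Fixpoint rec_graph (f g : nat -> nat -> Prop) (a n y : nat) : Prop :=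
  if n is m.+1 then
    exists z, rec_graph f g a m z /\ g (npair a (npair m z)) y
  else f a y.

(* [eval X c x y]: program [c] with oracle [X] halts on input [x] with output
   [y]. *)
Fixpoint eval (X : set nat) (c : code) (x y : nat) : Prop :=
  match c with
  | CZero => y = 0
  | CSucc => y = x.+1
  | CFst => y = nfst x
  | CSnd => y = nsnd x
  | COracle => y = (x \in X)
  | CPair f g =>
      exists a b, [/\ eval X f x a, eval X g x b & y = npair a b]
  | CComp f g => exists a, eval X g x a /\ eval X f a y
  | CRec f g => rec_graph (eval X f) (eval X g) (nfst x) (nsnd x) y
  | CMu f => eval X f (npair x y) 0 /\
      forall z, z < y -> exists v, eval X f (npair x z) v.+1
  end.

Definition turing_reducible (A X : set nat) : Prop :=
  exists c, forall x y, eval X c x y <-> y = (x \in A).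

(* C.e. sets are the domains of the partial recursive functions; the oracle
   [set0] contributes only the constant function 0. *)
Definition ce (W : set nat) : Prop :=
  exists c, W = [set x | exists y, eval set0 c x y].

(* The canonical finite set D_u: the positions of the binary digits 1 of u. *)
Definition canonical_finset (u : nat) : set nat := [set n | Nat.testbit u n].

Definition eoperator (Theta X : set nat) : set nat :=
  [set n | exists u, canonical_finset u `<=` X /\ Theta (npair u n)].

Definition enum_reducible (A X : set nat) : Prop :=
  exists Theta, ce Theta /\ A = eoperator Theta X.

Definition introenumerable (A : set nat) : Prop :=
  infinite_set A /\
  forall C, infinite_set C -> C `<=` A -> enum_reducible A C.

Definition uniformly_introenumerable (A : set nat) : Prop :=
  infinite_set A /\
  exists Theta, ce Theta /\
    forall C, infinite_set C -> C `<=` A -> eoperator Theta C = A.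

Definition introreducible (A : set nat) : Prop :=
  infinite_set A /\
  forall C, infinite_set C -> C `<=` A -> turing_reducible A C.

(* For infinite A, the n-th element of A in increasing order, counting from 0:
   the element of A with exactly n elements of A below it. *)
Definition principal (A : set nat) (n : nat) : nat :=
  xget 0 [set x | A x /\ count (fun y => y \in A) (iota 0 x) = n].

Definition graph_code (f : nat -> nat) : set nat := [set npair n (f n) | n in setT].

Definition majorenumerable (A : set nat) : Prop :=
  infinite_set A /\
  forall f : nat -> nat,
    (forall n, principal A n <= f n) -> enum_reducible A (graph_code f).

(* Main.v *)
(** A real [G] in Cantor space is coded by its residues [residue G n] modulo
    [2 ^ n].  The set [guesses G] consists of pairs of candidates of level [n],
    at least one of which is the true residue; there are two tagged copies of
    each pair, the second being present only if the column [n] of [G] is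
    nonempty, an event that is c.e. but not computable in [G].

    An infinite [C] included in [guesses G] enumerates [G], hence [guesses G].
    Either the two candidates of members of [C] agree modulo arbitrarily high
    powers of 2, and common residues are true; or from some [k0] on they
    disagree modulo [2 ^ k0], and the finite information [residue G k0] tells
    the true one.

    The negative properties hold for a sufficiently generic [G], built from
    conditions fixing finitely many bits and promising that finitely many
    columns receive no further elements.  If [G] and [H] are incompatible, the
    set of pairs (residue of [G], residue of [H]) lies in both [guesses G] and
    [guesses H], so no single operator can serve both.  The pairs with equal
    candidates cannot decide which second copies are present.  Finally, if [A]
    is majorenumerable, Hechler forcing shows that [A] belongs to a countable
    family of sets that does not depend on [A], which genericity avoids. *)

Require Import Defs.
From Stdlib Require Cantor PeanoNat.
From HB Require Import structures.
From mathcomp Require Import all_boot.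
From mathcomp Require Import boolp classical_sets cardinality.
From mathcomp Require Import zify.

Set Implicit Arguments.
Unset Strict Implicit.
Unset Printing Implicit Defensive.

Local Open Scope classical_set_scope.

(** * Cantor pairing: projections, injectivity, monotonicity *)

Lemma nfst_pair a b : nfst (npair a b) = a.
Proof. by rewrite /nfst /npair Cantor.cancel_of_to. Qed.

Lemma nsnd_pair a b : nsnd (npair a b) = b.
Proof. by rewrite /nsnd /npair Cantor.cancel_of_to. Qed.

Lemma npairK x : npair (nfst x) (nsnd x) = x.
Proof. by rewrite /npair /nfst /nsnd -surjective_pairing Cantor.cancel_to_of. Qed.

Definition npairE := (nfst_pair, nsnd_pair).

Lemma npair_inj a b c d : npair a b = npair c d -> a = c /\ b = d.
Proof.
by move=> h; rewrite -(nfst_pair a b) -{2}(nsnd_pair a b) h !npairE.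
Qed.

Lemma leq_npair a b c d : a <= c -> b <= d -> npair a b <= npair c d.
Proof.
move=> ac bd; rewrite /npair.
have := Cantor.to_nat_spec a b; have := Cantor.to_nat_spec c d.
move: (Cantor.to_nat _) (Cantor.to_nat _) => u v hu hv.
have : (b + a) * (b + a).+1 <= (d + c) * (d + c).+1 by apply: leq_mul; lia.
by lia.
Qed.

Lemma leq_npairl a b : a <= npair a b.
Proof. by rewrite /npair; have := Cantor.to_nat_spec a b; nia. Qed.

Lemma leq_npairr a b : b <= npair a b.
Proof. by rewrite /npair; have := Cantor.to_nat_spec a b; nia. Qed.

(** * Computable functions and c.e. predicates *)

(** The equivalence records totality and single-valuedness of the program at once. *)
Definition computable (f : nat -> nat) :=
  exists c, forall x y, eval set0 c x y <-> y = f x.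

Lemma eq_computable f g : f =1 g -> computable f -> computable g.
Proof. by move=> fg [c cP]; exists c => x y; rewrite cP fg. Qed.

Lemma computable_comp f g :
  computable f -> computable g -> computable (fun z => f (g z)).
Proof.
move=> [c cP] [d dP]; exists (CComp c d) => x y /=; split.
  by move=> [a [/dP -> /cP]].
by move=> ->; exists (g x); split; [apply/dP|apply/cP].
Qed.

Lemma computable_fst f : computable f -> computable (fun z => nfst (f z)).
Proof. by apply: computable_comp; exists CFst. Qed.

Lemma computable_snd f : computable f -> computable (fun z => nsnd (f z)).
Proof. by apply: computable_comp; exists CSnd. Qed.

Lemma computable_succ f : computable f -> computable (fun z => (f z).+1).
Proof. by apply: (@computable_comp succn); exists CSucc. Qed.

Lemma computable_pair f g :
  computable f -> computable g -> computable (fun z => npair (f z) (g z)).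
Proof.
move=> [c cP] [d dP]; exists (CPair c d) => x y /=; split.
  by move=> [a [b [/cP -> /dP -> ->]]].
by move=> ->; exists (f x), (g x); split=> //; [apply/cP|apply/dP].
Qed.

Lemma computable_id : computable (fun z => z).
Proof.
apply: (@eq_computable (fun z => npair (nfst z) (nsnd z))); first exact: npairK.
by apply: computable_pair; [exists CFst|exists CSnd].
Qed.

Lemma computable_cst n : computable (fun=> n).
Proof. by elim: n => [|n IH]; [exists CZero|exact: computable_succ]. Qed.

Fixpoint prec (f g : nat -> nat) (a n : nat) : nat :=
  if n is m.+1 then g (npair a (npair m (prec f g a m))) else f a.

Lemma computable_prec f g h k :
  computable f -> computable g -> computable h -> computable k ->
  computable (fun z => prec f g (h z) (k z)).
Proof.
move=> [c cP] [d dP] hC kC.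
apply: (@eq_computable
  (fun z => (fun u => prec f g (nfst u) (nsnd u)) (npair (h z) (k z)))).
  by move=> z /=; rewrite !npairE.
apply: (computable_comp (f := fun u => prec f g (nfst u) (nsnd u)));
  last exact: computable_pair.
exists (CRec c d) => x y /=; elim: (nsnd x) y => [|m IH] y /=; first exact: cP.
split; first by move=> [z [/IH -> /dP]].
by move=> ->; eexists; split; [apply/IH|apply/dP].
Qed.

Ltac computable_tac := repeat first
  [ assumption | apply computable_id | apply computable_fst
  | apply computable_snd | apply computable_succ | apply computable_pair
  | apply computable_cst ].

Lemma computable_add f g :
  computable f -> computable g -> computable (fun z => f z + g z).
Proof.
move=> fC gC; apply: (@eq_computable
  (fun z => prec id (fun u => (nsnd (nsnd u)).+1) (f z) (g z))).
  move=> z; elim: (g z) => [|n IH] /=; first by rewrite addn0.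
  by rewrite !npairE IH addnS.
by apply: computable_prec; computable_tac.
Qed.

Lemma computable_mul f g :
  computable f -> computable g -> computable (fun z => f z * g z).
Proof.
move=> fC gC; apply: (@eq_computable
  (fun z => prec (fun=> 0) (fun u => nfst u + nsnd (nsnd u)) (f z) (g z))).
  move=> z; elim: (g z) => [|n IH] /=; first by rewrite muln0.
  by rewrite !npairE IH mulnS.
by apply: computable_prec; computable_tac; apply: computable_add; computable_tac.
Qed.

Lemma computable_pow2 f : computable f -> computable (fun z => 2 ^ f z).
Proof.
move=> fC; apply: (@eq_computable
  (fun z => prec (fun=> 1) (fun u => 2 * nsnd (nsnd u)) 0 (f z))).
  move=> z; elim: (f z) => [|n IH] //=.
  by rewrite !npairE IH expnS.
by apply: computable_prec; computable_tac; apply: computable_mul; computable_tac.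
Qed.

Lemma computable_sub f g :
  computable f -> computable g -> computable (fun z => f z - g z).
Proof.
move=> fC gC; pose predr := prec (fun=> 0) (fun u => nfst (nsnd u)) 0.
have predE n : predr n = n.-1 by case: n => [|n] //=; rewrite /predr /= !npairE.
apply: (@eq_computable
  (fun z => prec id (fun u => predr (nsnd (nsnd u))) (f z) (g z))).
  move=> z; elim: (g z) => [|n IH] /=; first by rewrite subn0.
  by rewrite !npairE IH predE subnS.
by apply: computable_prec; computable_tac; apply: computable_prec; computable_tac.
Qed.

(** With a total computable matrix, conjunction becomes a sum, disjunction a product, and [P] the
    domain of an unbounded search. *)
Definition sigma1 (P : nat -> Prop) :=
  exists2 f, computable f & forall z, P z <-> exists w, f (npair z w) = 0.

Lemma sigma1_ce P : sigma1 P -> ce [set z | P z].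
Proof.
move=> [f [c cP] fP]; exists (CMu c); apply/seteqP; split=> z /=.
  move=> /fP ex0; have ex : exists w, f (npair z w) == 0.
    by case: ex0 => w /eqP; exists w.
  exists (ex_minn ex); case: ex_minnP => y /eqP fy ymin; split; first exact/cP.
  move=> w wy; exists (f (npair z w)).-1; apply/cP.
  rewrite prednK // lt0n; apply/negP => /ymin; lia.
by move=> [y [/cP fy _]]; apply/fP; exists y.
Qed.

Lemma sigma1_eq f g :
  computable f -> computable g -> sigma1 (fun z => f z = g z).
Proof.
move=> fC gC; exists (fun u => (f (nfst u) - g (nfst u)) + (g (nfst u) - f (nfst u))).
  have fC' : computable (fun u => f (nfst u)).
    by apply: computable_comp => //; computable_tac.
  have gC' : computable (fun u => g (nfst u)).
    by apply: computable_comp => //; computable_tac.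
  by apply: computable_add; apply: computable_sub.
move=> z; split; first by move=> fg; exists 0; rewrite !npairE fg; lia.
by move=> [w]; rewrite !npairE; lia.
Qed.

Lemma sigma1_and P Q : sigma1 P -> sigma1 Q -> sigma1 (fun z => P z /\ Q z).
Proof.
move=> [f fC fP] [g gC gP].
exists (fun u => f (npair (nfst u) (nfst (nsnd u)))
               + g (npair (nfst u) (nsnd (nsnd u)))).
  by apply: computable_add; apply: computable_comp => //; computable_tac.
move=> z; rewrite fP gP; split.
  by move=> [[a fa] [b gb]]; exists (npair a b); rewrite !npairE fa gb.
move=> [w]; rewrite !npairE => /eqP; rewrite addn_eq0 => /andP[/eqP a /eqP b].
by split; [exists (nfst w)|exists (nsnd w)].
Qed.

Lemma sigma1_or P Q : sigma1 P -> sigma1 Q -> sigma1 (fun z => P z \/ Q z).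
Proof.
move=> [f fC fP] [g gC gP]; exists (fun u => f u * g u); first exact: computable_mul.
move=> z; rewrite fP gP; split.
  by move=> [[a fa]|[a fa]]; exists a; rewrite fa ?muln0.
move=> [w] /eqP; rewrite muln_eq0 => /orP[]/eqP h; first by left; exists w.
by right; exists w.
Qed.

Lemma sigma1_ex (P : nat -> nat -> Prop) :
  sigma1 (fun z => P (nfst z) (nsnd z)) -> sigma1 (fun z => exists w, P z w).
Proof.
move=> [f fC fP].
exists (fun u => f (npair (npair (nfst u) (nfst (nsnd u))) (nsnd (nsnd u)))).
  by apply: computable_comp => //; computable_tac.
move=> z; split.
  move=> [w Pzw]; have /fP[v fv] : P (nfst (npair z w)) (nsnd (npair z w)).
    by rewrite !npairE.
  by exists (npair w v); rewrite !npairE.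
move=> [w]; rewrite !npairE => fw; exists (nfst w).
have : P (nfst (npair z (nfst w))) (nsnd (npair z (nfst w))).
  by apply/fP; exists (nsnd w).
by rewrite !npairE.
Qed.

Lemma eq_sigma1 P Q : (forall z, P z <-> Q z) -> sigma1 P -> sigma1 Q.
Proof. by move=> PQ [f fC fP]; exists f => // z; rewrite -PQ. Qed.

Lemma sigma1_comp P f :
  sigma1 P -> computable f -> sigma1 (fun z => P (f z)).
Proof.
move=> [g gC gP] fC; exists (fun u => g (npair (f (nfst u)) (nsnd u))).
  apply: computable_comp => //; apply: computable_pair; computable_tac.
  by apply: computable_comp => //; computable_tac.
by move=> z; rewrite gP; split=> -[w gw]; exists w; move: gw; rewrite !npairE.
Qed.

Lemma sigma1_leq f g :
  computable f -> computable g -> sigma1 (fun z => f z <= g z).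
Proof.
move=> fC gC; apply: (@eq_sigma1 (fun z => f z - g z = 0)).
  by move=> z; split; lia.
by apply: sigma1_eq; [exact: computable_sub|exact: computable_cst].
Qed.

(** Congruence is witnessed by two multiples of the modulus that equalize the sides, so no remainder
    has to be computed. *)
Lemma sigma1_modn f g h : computable f -> computable g -> computable h ->
  sigma1 (fun z => f z = g z %[mod h z]).
Proof.
move=> fC gC hC.
apply: (@eq_sigma1 (fun z => exists q r, f z + q * h z = g z + r * h z)).
  move=> z; split.
    move=> [q [r e]].
    by rewrite -(modnMDl q (f z)) -(modnMDl r (g z)) addnC e addnC.
  move=> e; exists (g z %/ h z), (f z %/ h z).
  by rewrite {1}(divn_eq (f z) (h z)) {2}(divn_eq (g z) (h z)) e; lia.
apply: sigma1_ex; apply: sigma1_ex.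
have C k : computable k -> computable (fun z => k (nfst (nfst z))).
  by move=> kC; apply: computable_comp => //; computable_tac.
by apply: sigma1_eq; apply: computable_add; (try exact: C);
  apply: computable_mul; (try exact: C); computable_tac.
Qed.

Ltac sigma1_tac := repeat first
  [ assumption | apply sigma1_and | apply sigma1_or | apply sigma1_ex
  | apply sigma1_modn | apply sigma1_leq | apply sigma1_eq
  | progress computable_tac | apply computable_add | apply computable_mul
  | apply computable_pow2 ].

(** * Finite use *)

(** A halting computation consults finitely many oracle bits; the bounds of its subcomputations are
    merged by [maxn]. *)
Lemma eval_use X c x y : eval X c x y ->
  exists K, forall Y, (forall i, i < K -> (i \in X) = (i \in Y)) -> eval Y c x y.
Proof.
have max2 (P Q : set nat -> Prop) :
    (exists K, forall Y, (forall i, i < K -> (i \in X) = (i \in Y)) -> P Y) ->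
    (exists K, forall Y, (forall i, i < K -> (i \in X) = (i \in Y)) -> Q Y) ->
    exists K, forall Y, (forall i, i < K -> (i \in X) = (i \in Y)) -> P Y /\ Q Y.
  move=> [K KP] [L LQ]; exists (maxn K L) => Y XY.
  by split; [apply: KP|apply: LQ] => i iK; apply: XY; lia.
elim: c x y => /=.
- by move=> x y ->; exists 0.
- by move=> x y ->; exists 0.
- by move=> x y ->; exists 0.
- by move=> x y ->; exists 0.
- by move=> x y ->; exists x.+1 => Y ->.
- move=> f IHf g IHg x y [a [b [/IHf fa /IHg gb ->]]].
  by have [K KP] := max2 _ _ fa gb; exists K => Y /KP[? ?]; exists a, b.
- move=> f IHf g IHg x y [a [/IHg ga /IHf fa]].
  by have [K KP] := max2 _ _ ga fa; exists K => Y /KP[? ?]; exists a.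
- move=> f IHf g IHg x y; elim: (nsnd x) y => [|n IHn] y /=; first exact: IHf.
  move=> [z [/IHn fz /IHg gz]].
  by have [K KP] := max2 _ _ fz gz; exists K => Y /KP[? ?]; exists z.
- move=> f IHf x y [/IHf f0 fS]; apply: (max2 _ _ f0) => {f0}.
  (* The finitely many failed tests of the search are merged one at a time. *)
  elim: y fS => [|y IHy] fS; first by exists 0.
  have [v /IHf fv] := fS _ (ltnSn y).
  have [K KP] := max2 _ _ (IHy (fun z zy => fS z (ltnW zy))) fv.
  exists K => Y /KP[Y1 Y2] z; rewrite ltnS leq_eqVlt => /orP[/eqP ->|]; last exact: Y1.
  by exists v.
Qed.

(** Enumeration operators are monotone, so only membership below the bound must be preserved, not
    absence. *)
Lemma eoperator_use Theta X x : eoperator Theta X x ->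
  exists K, forall Y, (forall i, i < K -> X i -> Y i) -> eoperator Theta Y x.
Proof.
move=> [u [uX ux]]; exists (Nat.log2 u).+1 => Y XY; exists u; split=> // i ui.
apply: XY; last exact: uX.
rewrite ltnNge; apply/negP => h; move: ui; rewrite /canonical_finset /=.
by rewrite PeanoNat.Nat.bits_above_log2 //; lia.
Qed.

(** Operators whose axioms use a single element can thus be described by arithmetic alone. *)
Lemma canonical_finset_pow2 x : canonical_finset (2 ^ x) = [set x].
Proof.
have -> : 2 ^ x = Nat.pow 2 x by elim: x => // n IH; rewrite expnS IH /=; lia.
apply/seteqP; split=> y; rewrite /canonical_finset /= PeanoNat.Nat.pow2_bits_eqb.
  by move=> /PeanoNat.Nat.eqb_eq.
by move=> ->; apply/PeanoNat.Nat.eqb_eq.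
Qed.

(** * Generic objects *)

(** The embedding into trees makes [code] countable, so that programs can index requirements. *)
Fixpoint code_tree (c : code) : GenTree.tree nat :=
  match c with
  | CZero => GenTree.Leaf 0
  | CSucc => GenTree.Leaf 1
  | CFst => GenTree.Leaf 2
  | CSnd => GenTree.Leaf 3
  | COracle => GenTree.Leaf 4
  | CPair f g => GenTree.Node 0 [:: code_tree f; code_tree g]
  | CComp f g => GenTree.Node 1 [:: code_tree f; code_tree g]
  | CRec f g => GenTree.Node 2 [:: code_tree f; code_tree g]
  | CMu f => GenTree.Node 3 [:: code_tree f]
  end.

Fixpoint tree_code (t : GenTree.tree nat) : code :=
  match t with
  | GenTree.Leaf 0 => CZero
  | GenTree.Leaf 1 => CSucc
  | GenTree.Leaf 2 => CFst
  | GenTree.Leaf 3 => CSnd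
  | GenTree.Leaf _ => COracle
  | GenTree.Node 0 [:: f; g] => CPair (tree_code f) (tree_code g)
  | GenTree.Node 1 [:: f; g] => CComp (tree_code f) (tree_code g)
  | GenTree.Node 2 [:: f; g] => CRec (tree_code f) (tree_code g)
  | GenTree.Node _ [:: f] => CMu (tree_code f)
  | GenTree.Node _ _ => CZero
  end.

Lemma code_treeK : cancel code_tree tree_code.
Proof. by elim=> //= [f -> g ->|f -> g ->|f -> g ->|f ->]. Qed.

HB.instance Definition _ := Countable.copy code (can_type code_treeK).

(** A Rasiowa-Sikorski argument: along a decreasing sequence of conditions, stage [n] decides the
    value at [n] and meets the requirement numbered [n], if any. Closedness of each [D p] puts the
    limit in all conditions. *)
Lemma generic_exists (T P : Type) (D : P -> set (nat -> T)) (I : countType)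
    (Req : I -> set (nat -> T)) (p0 : P) :
  (forall p, D p !=set0) ->
  (forall p f, (forall n, exists2 g, D p g & forall i, i < n -> g i = f i) ->
    D p f) ->
  (forall n p, exists2 q, D q `<=` D p &
    exists a, forall f, D q f -> f n = a) ->
  (forall i p, exists2 q, D q `<=` D p & D q `<=` Req i) ->
  exists2 f, D p0 f & forall i, Req i f.
Proof.
move=> D0 Dclosed Ddecide Dreq.
have /choice[next nextP] : forall np : nat * P, exists q,
    [/\ D q `<=` D np.2, exists a, forall f, D q f -> f np.1 = a
      & forall i, unpickle np.1 = Some i -> D q `<=` Req i].
  move=> [n p] /=.
  have [q qp [a qa]] := Ddecide n p.
  case E: (unpickle n) => [i|]; last by exists q; split=> //; exists a.
  have [r rq rR] := Dreq i q; exists r; split.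
  - exact: subset_trans rq qp.
  - by exists a => f /rq; exact: qa.
  - by move=> _ [<-].
pose fix s n := if n is m.+1 then next (m, s m) else p0.
have s_le m n : m <= n -> D (s n) `<=` D (s m).
  elim: n => [|n IH]; first by rewrite leqn0 => /eqP ->.
  rewrite leq_eqVlt => /orP[/eqP -> //|/IH]; apply: subset_trans.
  by have [] := nextP (n, s n).
have [g gP] := choice (fun n => D0 (s n)).
(* All members of [D (s n.+1)] share their value at [n]. *)
pose G n := g n.+1 n.
have Gs n : D (s n) G.
  apply: Dclosed => m; exists (g (maxn m n)).
    by apply: (s_le _ _ _ _ (gP _)); lia.
  move=> i im; have [_ [a aP] _] := nextP (i, s i).
  rewrite /G (aP (g i.+1)) ?(aP (g (maxn m n))) //; last exact: (gP i.+1).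
  by apply: (s_le i.+1 _ _ _ (gP _)); lia.
exists G; first exact: (Gs 0).
move=> i; have [_ _ R] := nextP (pickle i, s (pickle i)).
by apply: (R i); [rewrite /= pickleK|exact: (Gs (pickle i).+1)].
Qed.

Definition dom (c : code) : set nat := [set x | exists y, eval set0 c x y].

(** * Majorants *)

Definition hechler (p : seq nat * (nat -> nat)) : set (nat -> nat) :=
  [set f | (forall i, i < size p.1 -> f i = nth 0 p.1 i) /\
           (forall i, size p.1 <= i -> p.2 i <= f i)].

(** The numbers that no Hechler condition with stem [s] forces out. Quantifying over all bounds [h]
    leaves only a program and a finite stem as parameters, hence a countable family. *)
Definition forced_by_majorants (c : code) (s : seq nat) : set nat :=
  [set x | forall h, exists2 f, hechler (s, h) f &
                     eoperator (dom c) (graph_code f) x].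

Lemma hechler_extend s h h' f K : hechler (s, h) f -> size s <= K ->
  (forall i, h i <= h' i) -> hechler (mkseq f K, h') `<=` hechler (s, h).
Proof.
move=> [fs fh] sK hh' g [/=]; rewrite size_mkseq => gf gh; split=> /= i si.
  by rewrite gf ?nth_mkseq ?fs //; lia.
case: (ltnP i K) => iK; first by rewrite gf // nth_mkseq //; exact: fh.
exact: leq_trans (hh' i) (gh i iK).
Qed.

(** A Hechler-generic function above [principal A] defeats each program [c]: given a stem [s], use a
    point where [A] and [forced_by_majorants c s] differ. *)
Lemma not_majorenumerable (A : set nat) :
  (forall c s, A <> forced_by_majorants c s) -> ~ majorenumerable A.
Proof.
move=> Anew [_ Amaj].
have mem p : hechler p (fun i => if i < size p.1 then nth 0 p.1 i else p.2 i).
  by split=> i /=; [move=> ->|case: ltnP].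
suff [f fA fR] : exists2 f, hechler ([::], principal A) f &
    forall c, A <> eoperator (dom c) (graph_code f).
  have [_ [[c ->]]] : enum_reducible A (graph_code f).
    by apply: Amaj => n; apply: fA.2.
  exact: fR.
apply: (@generic_exists nat _ hechler _
  (fun c f => A <> eoperator (dom c) (graph_code f))).
- by move=> p; eexists; exact: mem.
- move=> [s h] f fP; split=> /= i si.
    by have [g [gs _] <-] := fP i.+1; rewrite ?gs.
  by have [g [_ gs] <-] := fP i.+1; rewrite ?gs.
- move=> n [s h]; have := mem (s, h); set f := (fun i => _) => fP.
  exists (mkseq f (maxn (size s) n.+1), h); first by apply: (hechler_extend fP) => /=; lia.
  exists (f n) => g [/= + _]; rewrite size_mkseq => ->; last lia.
  by rewrite nth_mkseq //; lia.
- move=> c [s h].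
  have [x xAB] : exists x, ~ (A x <-> forced_by_majorants c s x).
    apply: contrapT => /forallNP AB; apply: (Anew c s).
    by apply/seteqP; split=> x; have /contrapT[] := AB x.
  (* If [x] is outside [A], some member of the condition enumerates [x], and fixing its use in the
     stem keeps [x] enumerated. *)
  case: (pselect (A x)) => Ax; last first.
    have /(_ h)[f fP /eoperator_use[K KP]] : forced_by_majorants c s x.
      by apply: contrapT => nB; apply: xAB; split.
    exists (mkseq f (maxn (size s) K), h); first by apply: (hechler_extend fP) => /=; lia.
    move=> g [/= + _]; rewrite size_mkseq => gf AE; apply: Ax; rewrite AE.
    apply: KP => y yK [i _ iy]; exists i => //; rewrite -iy; congr npair.
    (* An argument is at most the code of its graph point, so values below [K] cover the use. *)
    have iK : i < K by rewrite (leq_ltn_trans _ yK) // -iy leq_npairl.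
    by rewrite gf ?nth_mkseq //; lia.
  (* If [x] is in [A], some bound [h'] excludes [x] for the stem [s]; the maximum with [h] refines
     both. *)
  have /existsNP[h' h'P] : ~ forced_by_majorants c s x.
    by move=> B; apply: xAB; split.
  exists (s, fun i => maxn (h i) (h' i)).
    by move=> f [fs fh]; split=> //= i /fh /=; lia.
  move=> f [fs fh] AE; apply: h'P; exists f; last by rewrite -AE.
  by split=> //= i /fh /=; lia.
Qed.

(** * The set of guesses *)

Definition residue (G : nat -> bool) (n : nat) : nat := \sum_(i < n) G i * 2 ^ i.

Lemma residueS G n : residue G n.+1 = residue G n + G n * 2 ^ n.
Proof. by rewrite /residue big_ord_recr. Qed.

Lemma residue_lt G n : residue G n < 2 ^ n.
Proof.
elim: n => [|n IH]; first by rewrite /residue big_ord0.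
by rewrite residueS expnS; case: (G n); lia.
Qed.

Lemma eq_residue G H n : (forall i, i < n -> G i = H i) -> residue G n = residue H n.
Proof. by move=> GH; apply: eq_bigr => i _; rewrite GH. Qed.

Lemma residue_mod G n k : n <= k -> residue G k = residue G n %[mod 2 ^ n].
Proof.
elim: k => [|k IH]; first by rewrite leqn0 => /eqP ->.
rewrite leq_eqVlt => /orP[/eqP -> //|nk]; rewrite residueS -IH //.
by rewrite -(subnKC (ltnSE nk)) expnD mulnCA -modnDmr modnMr addn0.
Qed.

Lemma residue_unique G n k t : n <= k -> t < 2 ^ n ->
  residue G k = t %[mod 2 ^ n] -> t = residue G n.
Proof.
move=> nk tn; rewrite residue_mod // (modn_small tn) => <-.
by rewrite modn_small // residue_lt.
Qed.

(** The top bit decides: one side is below [2 ^ i], the other is not, whatever the lower bits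
    are. *)
Lemma residue_neq G H i : G i = false -> H i = true ->
  residue G i.+1 <> residue H i.+1.
Proof.
by rewrite !residueS => -> ->; have := residue_lt G i; lia.
Qed.

Definition elem (n j v w : nat) : nat := npair (npair n j) (npair v w).
Definition level (x : nat) : nat := nfst (nfst x).
Definition tag (x : nat) : nat := nsnd (nfst x).
Definition lft (x : nat) : nat := nfst (nsnd x).
Definition rgt (x : nat) : nat := nsnd (nsnd x).

Lemma level_elem n j v w : level (elem n j v w) = n.
Proof. by rewrite /level /elem !npairE. Qed.

Lemma tag_elem n j v w : tag (elem n j v w) = j.
Proof. by rewrite /tag /elem !npairE. Qed.

Lemma lft_elem n j v w : lft (elem n j v w) = v.
Proof. by rewrite /lft /elem !npairE. Qed.

Lemma rgt_elem n j v w : rgt (elem n j v w) = w.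
Proof. by rewrite /rgt /elem !npairE. Qed.

Definition elemE := (level_elem, tag_elem, lft_elem, rgt_elem).

Lemma leq_elem n j v w : n <= elem n j v w.
Proof. exact: leq_trans (leq_npairl n j) (leq_npairl _ _). Qed.

Definition hits (G : nat -> bool) (n : nat) : Prop := exists m, G (npair n m).

Definition guesses (G : nat -> bool) : set nat :=
  [set x | [/\ lft x < 2 ^ level x, rgt x < 2 ^ level x,
               lft x = residue G (level x) \/ rgt x = residue G (level x)
             & tag x = 0 \/ tag x = 1 /\ hits G (level x)]].

(** Tag 0 keeps membership independent of [hits], so finitely many bits of [G] and [H] determine
    each element. *)
Definition pairs (G H : nat -> bool) : set nat :=
  [set elem n 0 (residue G n) (residue H n) | n in setT].

Lemma pairs_infinite G H : infinite_set (pairs G H).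
Proof.
move=> /(finite_image level); apply/infiniteP; rewrite (_ : _ @` _ = setT).
  exact/infiniteP/infinite_nat.
apply/seteqP; split=> // n _; eexists; first by exists n.
by rewrite elemE.
Qed.

Lemma pairs_subl G H : pairs G H `<=` guesses G.
Proof.
move=> x [n _ <-]; rewrite /guesses /= !elemE !residue_lt; split=> //; by left.
Qed.

Lemma pairs_subr G H : pairs G H `<=` guesses H.
Proof.
move=> x [n _ <-]; rewrite /guesses /= !elemE !residue_lt.
by split=> //; [right|left].
Qed.

Lemma pairs_agree G G' H H' K : (forall i, i < K -> G i = G' i) ->
  (forall i, i < K -> H i = H' i) ->
  forall x, x < K -> pairs G H x -> pairs G' H' x.
Proof.
move=> GG' HH' x xK [n _ nx]; exists n => //.
have nK : n < K by rewrite (leq_ltn_trans _ xK) // -nx leq_elem.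
by rewrite -nx; congr elem; apply: eq_residue => i ni; [rewrite GG'|rewrite HH'] => //; lia.
Qed.

(** * Recovering the set of guesses from an infinite subset *)

Lemma guesses_level_unbounded G C : infinite_set C -> C `<=` guesses G ->
  forall N, exists2 x, C x & N <= level x.
Proof.
move=> Cinf CA N; apply: contrapT => noN; apply: Cinf.
(* Below level [N] the candidates are below [2 ^ N] and the tag is at most 1; monotonicity of
   pairing bounds the element. *)
apply: (@sub_finite_set _ _ `I_(elem N 1 (2 ^ N) (2 ^ N)).+1); last exact: finite_II.
move=> x Cx; have [xl xr _ xj] := CA _ Cx.
have xN : level x < N by rewrite ltnNge; apply/negP => h; apply: noN; exists x.
have pN : 2 ^ level x <= 2 ^ N by rewrite leq_exp2l //; lia.
rewrite /= ltnS -(npairK x) -(npairK (nfst x)) -(npairK (nsnd x)).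
rewrite -/(level x) -/(lft x) -/(rgt x) -/(tag x).
by do 2?apply: leq_npair; try lia; case: xj => [->|[->]].
Qed.

(* What a true residue [t] of level [k] certifies: a member [x] of [guesses G],
   the hit of column [level x] being read off a bit of [t]. *)
Definition yields (k t x : nat) : Prop :=
  level x <= k /\ lft x < 2 ^ level x /\ rgt x < 2 ^ level x /\
  (t = lft x %[mod 2 ^ level x] \/ t = rgt x %[mod 2 ^ level x]) /\
  (tag x = 0 \/ tag x = 1 /\ exists m r,
    npair (level x) m < k /\ r < 2 ^ npair (level x) m /\
    t = r + 2 ^ npair (level x) m %[mod 2 ^ (npair (level x) m).+1]).

(** The certificate for tag 1 says that bit [npair (level x) m] of [t] is 1, since the remainder [r]
    fits below that bit. *)
Lemma yields_sound G k x : yields k (residue G k) x -> guesses G x.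
Proof.
move=> [nk [xl [xr [xt xj]]]]; split=> //.
  by case: xt => /(residue_unique nk); [left|right]; auto.
case: xj => [->|[-> [m [r [mk [rm rt]]]]]]; first by left.
right; split=> //; exists m; move: (npair _ _) mk rm rt => q qk rq.
move/(residue_unique qk); rewrite residueS expnS => e.
by case: (G q) e => //; have := residue_lt G q; lia.
Qed.

Lemma yields_complete G x : guesses G x ->
  exists K, forall k, K <= k -> yields k (residue G k) x.
Proof.
move=> [xl xr xt xj].
have Gt k : level x <= k -> residue G k = lft x %[mod 2 ^ level x] \/
    residue G k = rgt x %[mod 2 ^ level x].
  by move=> nk; rewrite (residue_mod G nk); case: xt => ->; [left|right].
case: xj => [x0|[x1 [m Gm]]].
  by exists (level x) => k nk; do 4!split=> //; [exact: Gt|left].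
exists (npair (level x) m).+1 => k nk.
have lk : level x <= k by have := leq_npairl (level x) m; lia.
do 4!split=> //; [exact: Gt|right; split=> //].
exists m, (residue G (npair (level x) m)); do 2!split=> //; first exact: residue_lt.
by rewrite (residue_mod G nk) residueS Gm mul1n.
Qed.

(** [sel x k t] is a c.e. rule reading a residue [t] of level [k] off one element [x]. If it never
    errs on [C] and succeeds at unbounded levels, [yields] turns the residues into the whole set. *)
Lemma guesses_enum_reducible G C (sel : nat -> nat -> nat -> Prop) :
  sigma1 (fun z => sel (nfst (nfst z)) (nsnd (nfst z)) (nsnd z)) ->
  (forall x k t, C x -> sel x k t -> t = residue G k) ->
  (forall K, exists x k, [/\ C x, K <= k & sel x k (residue G k)]) ->
  enum_reducible (guesses G) C.
Proof.
move=> sel1 selS selC.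
pose Theta := [set z | exists x k t, nfst z = 2 ^ x /\
  (sel x k t /\ yields k t (nsnd z))].
exists Theta; split.
  apply: sigma1_ce; apply: sigma1_ex; apply: sigma1_ex; apply: sigma1_ex.
  apply: sigma1_and; first by sigma1_tac.
  apply: sigma1_and.
    apply: (@eq_sigma1 _ _ _ (sigma1_comp (f := fun z =>
      npair (npair (nsnd (nfst (nfst z))) (nsnd (nfst z))) (nsnd z)) sel1 _)).
      by move=> z; rewrite !npairE.
    by sigma1_tac.
  by rewrite /yields /level /lft /rgt /tag; sigma1_tac.
apply/seteqP; split=> n.
  move=> /yields_complete[K KP]; have [x [k [Cx Kk xk]]] := selC K.
  exists (2 ^ x); rewrite canonical_finset_pow2; split; first by move=> _ ->.
  exists x, k, (residue G k); rewrite !npairE; split=> //; split=> //; exact: KP.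
move=> [u [uC [x [k [t]]]]]; rewrite !npairE => -[ux [xkt xy]].
have Cx : C x by apply: uC; rewrite ux canonical_finset_pow2.
by apply: (@yields_sound G k); rewrite -(selS x k t).
Qed.

Lemma guesses_introenumerable G : introenumerable (guesses G).
Proof.
split; first by move=> /(sub_finite_set (@pairs_subl G G)); exact: pairs_infinite.
move=> C Cinf CA; have Cunb := guesses_level_unbounded Cinf CA.
(* This case split, together with the number [p] below, is where uniformity is lost. *)
have [agree|/existsNP[k0 k0P]] := pselect (forall k, exists x, [/\ C x, k <= level x &
    lft x = rgt x %[mod 2 ^ k]]).
  apply: (@guesses_enum_reducible G C (fun x k t => k <= level x /\ t < 2 ^ k /\
      lft x = t %[mod 2 ^ k] /\ rgt x = t %[mod 2 ^ k])).
  - by rewrite /level /lft /rgt; sigma1_tac.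
  - move=> x k t /CA[_ _ xt _] [kx [tk [lt rt]]].
    by case: xt => e; apply: (residue_unique kx tk); rewrite -e.
  - move=> K; have [x [Cx Kx xlr]] := agree K; exists x, K; split=> //.
    do 2!split=> //; first exact: residue_lt.
    have [_ _ xt _] := CA x Cx; rewrite -(residue_mod G Kx).
    by case: xt => <-; rewrite xlr.
have differ x : C x -> k0 <= level x -> lft x <> rgt x %[mod 2 ^ k0].
  by move=> Cx kx e; apply: k0P; exists x.
pose p := residue G k0.
(* Incongruence to the constant [p], in existential form so that it is visibly c.e. *)
pose other y := exists u, u < 2 ^ k0 /\ (u < p \/ p < u) /\ y = u %[mod 2 ^ k0].
have otherP y : other y <-> y <> p %[mod 2 ^ k0].
  split.
    move=> [u [uk [up ->]]]; rewrite !modn_small ?residue_lt //; lia.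
  move=> yp; exists (y %% 2 ^ k0); rewrite modn_mod ltn_pmod ?expn_gt0 //.
  split=> //; split=> //; move: yp; rewrite (modn_small (residue_lt _ _)) -/p; lia.
apply: (@guesses_enum_reducible G C (fun x k t => k = level x /\ k0 <= level x /\
    (t = lft x /\ other (rgt x) \/ t = rgt x /\ other (lft x)))).
- by rewrite /other /level /lft /rgt; sigma1_tac.
- move=> x k t /CA[_ _ xt _] [-> [kx tP]].
  (* The true candidate is congruent to [p], so the one certified as [other] is false. *)
  by case: tP xt => -[-> /otherP o] [] e //; exfalso; apply: o; rewrite e residue_mod.
- move=> K; have [x Cx] := Cunb (maxn K k0); rewrite geq_max => /andP[Kx kx].
  exists x, (level x); split=> //; split=> //; split=> //.
  have d := differ x Cx kx; have [_ _ xt _] := CA x Cx.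
  case: xt => e; [left|right]; split=> //; apply/otherP => o; apply: d.
    by rewrite o e residue_mod.
  by rewrite o e residue_mod.
Qed.

(** * Genericity *)

(* The condition [(k, X, N)]: agree with [X] below [k], and put nothing more in
   the columns below [N]. *)
Definition freeze (p : nat * (nat -> bool) * nat) : set (nat -> bool) :=
  [set G | (forall i, i < p.1.1 -> G i = p.1.2 i) /\
           (forall n m, n < p.2 -> p.1.1 <= npair n m -> G (npair n m) = false)].

Lemma freeze_extend k X N G K N' : freeze (k, X, N) G -> k <= K -> N <= N' ->
  freeze (K, G, N') `<=` freeze (k, X, N).
Proof.
move=> [GX GN] kK NN' H [/= HG HN]; split=> [i ik|n m nN km] /=.
  by rewrite HG ?GX //; exact: leq_trans ik kK.
case: (ltnP (npair n m) K) => mK; first by rewrite HG // GN.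
by rewrite HN //; exact: leq_trans nN NN'.
Qed.

Lemma freeze_nonempty p : freeze p !=set0.
Proof.
by exists (fun i => (i < p.1.1) && p.1.2 i); split=> [i ->|n m _] //; rewrite ltnNge => ->.
Qed.

Lemma freeze_set p i n m G : freeze p G -> i = npair n m -> p.1.1 <= i -> p.2 <= n ->
  forall b, freeze p (fun j => if j == i then b else G j).
Proof.
move=> [GX GN] ei ki Nn b; split=> [j jk|n' m' nN km].
  by case: eqP => [e|_]; [lia|exact: GX].
by case: eqP => [/esym|_]; [rewrite ei => /npair_inj[]; lia|exact: GN].
Qed.

(** The bit [npair n 0] with [n = maxn k N] is still free. The two conditions differ there, and [x]
    has both candidates equal to the residue chosen by the first. *)
Lemma freeze_split p : exists q0 q1 x,
  [/\ freeze q0 `<=` freeze p, freeze q1 `<=` freeze p,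
      forall G, freeze q0 G -> guesses G x
    & forall G, freeze q1 G -> ~ guesses G x].
Proof.
case: p => [[k X] N]; have [G GP] := freeze_nonempty (k, X, N).
pose n := maxn k N; pose i := npair n 0.
have ni : n <= i := leq_npairl n 0.
pose Gb b j := if j == i then b else G j.
have GbP b : freeze (k, X, N) (Gb b).
  by apply: (freeze_set GP (erefl i)) => /=; lia.
have Gbi b : Gb b i = b by rewrite /Gb eqxx.
pose v := residue (Gb false) i.+1.
exists (i.+1, Gb false, N), (i.+1, Gb true, N), (elem i.+1 0 v v); split.
- by apply: (freeze_extend (GbP false)) => //; lia.
- by apply: (freeze_extend (GbP true)) => //; lia.
- move=> H [/= HG _]; rewrite /guesses /= !elemE residue_lt; split=> //; last by left.
  by left; apply: eq_residue => j ji; rewrite HG.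
- move=> H [/= HG _]; rewrite /guesses /= !elemE => -[_ _ vH _].
  have : v = residue H i.+1 by case: vH.
  by apply: residue_neq; rewrite ?HG.
Qed.

(** [q0] puts [x] in and [q1] keeps it out. If the operator enumerates [x] from some [pairs G H], it
    errs for extensions of [q1] preserving the use; otherwise it misses [x] for every [G] in
    [q0]. *)
Lemma dense_not_uniform c p : exists2 q, freeze q `<=` freeze p &
  forall G, freeze q G -> exists C,
    [/\ infinite_set C, C `<=` guesses G & eoperator (dom c) C <> guesses G].
Proof.
have [q0 [q1 [x [q0p q1p Ax nAx]]]] := freeze_split p.
have [[G [H [GP HP /eoperator_use[K KP]]]]|no] := pselect (exists G H,
    [/\ freeze q0 G, freeze q1 H & eoperator (dom c) (pairs G H) x]).
  case: q1 q1p nAx HP => [[k X] N] q1p nAx HP.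
  have Hq : freeze (maxn k K, H, N) `<=` freeze (k, X, N).
    by apply: (freeze_extend HP) => //; exact: leq_maxl.
  exists (maxn k K, H, N); first exact: subset_trans q1p.
  move=> H' H'P; exists (pairs G H'); split.
  - exact: pairs_infinite.
  - exact: pairs_subr.
  - move=> e; apply: (nAx H' (Hq _ H'P)); rewrite -e.
    apply: KP; apply: pairs_agree => // i iK.
    by case: H'P => /= ->; lia.
exists q0 => // G GP; have [H HP] := freeze_nonempty q1; exists (pairs G H); split.
- exact: pairs_infinite.
- exact: pairs_subl.
- by move=> e; apply: no; exists G, H; split=> //; rewrite e; exact: Ax.
Qed.

(** The element [x] is a second copy, present exactly when column [n] is hit. If the program can
    answer 0, hit the column beyond the use; otherwise freeze the column empty, making 0 the correct
    answer. *)
Lemma dense_not_introreducible c p : exists2 q, freeze q `<=` freeze p &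
  forall G, freeze q G ->
    ~ forall x y, eval (pairs G G) c x y <-> y = (x \in guesses G).
Proof.
case: p => [[k X] N]; have [G0 G0P] := freeze_nonempty (k, X, N).
pose n := maxn k N; pose p1 := (n, G0, N).
have p1p : freeze p1 `<=` freeze (k, X, N).
  by apply: (freeze_extend G0P) => //; lia.
pose v := residue G0 n; pose x := elem n 1 v v.
have xP G : freeze p1 G -> guesses G x <-> hits G n.
  move=> [/= GG0 _]; have vG : v = residue G n.
    by apply: eq_residue => i /GG0.
  rewrite /guesses /x /= !elemE vG !residue_lt; split; first by case=> _ _ _ [|[]].
  by move=> h; split=> //; [left|right].
have [[G [GP /eval_use[K KP]]]|no] := pselect (exists G,
    freeze p1 G /\ eval (pairs G G) c x 0).
  (* The new bit [i] lies beyond the use [K] and beyond the [n] bits fixed by [p1]. *)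
  pose L := maxn n K; pose i := npair n L.
  have Li : L <= i := leq_npairr n L.
  pose G1 j := if j == i then true else G j.
  have G1P : freeze p1 G1.
    by apply: (freeze_set GP (erefl i)) => /=; lia.
  have qp1 : freeze (i.+1, G1, N) `<=` freeze p1.
    by apply: (freeze_extend G1P) => //; lia.
  exists (i.+1, G1, N); first exact: subset_trans p1p.
  move=> H HP e; have HG j : j < L -> H j = G j.
    move=> jL; rewrite HP.1 /=; last by lia.
    by rewrite /G1; case: eqP => // ji; lia.
  have : eval (pairs H H) c x 0.
    apply: KP => j jK; apply/idP/idP; rewrite !inE.
      by apply: (@pairs_agree G H G H K) => // i' i'K; rewrite HG //; lia.
    by apply: (@pairs_agree H G H G K) => // i' i'K; rewrite HG //; lia.
  move/e; suff -> : x \in guesses H by [].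
  rewrite inE; apply/xP; first exact: qp1.
  by exists L; rewrite HP.1 //= /G1 eqxx.
(* Codes in column [n] are at least [n], so the promise covers the entire column. *)
have qp1 : freeze (n, G0, n.+1) `<=` freeze p1.
  move=> G [GG0 GN]; split=> //= n' m' n'N; apply: GN => /=; lia.
exists (n, G0, n.+1); first exact: subset_trans p1p.
move=> G GP e; apply: no; exists G; split; first exact: qp1.
apply/e; rewrite memNset // xP; last exact: qp1.
by move=> [m]; rewrite GP.2 //=; exact: leq_npairl.
Qed.

Lemma dense_neq B p : exists2 q, freeze q `<=` freeze p &
  forall G, freeze q G -> guesses G <> B.
Proof.
have [q0 [q1 [x [q0p q1p Ax nAx]]]] := freeze_split p.
have [Bx|nBx] := pselect (B x).
  by exists q1 => // G GP e; apply: (nAx G GP); rewrite e.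
by exists q0 => // G GP e; apply: nBx; rewrite -e; exact: Ax.
Qed.

Theorem theorem4p15 :
  exists A : set nat,
    [/\ introenumerable A,
        ~ uniformly_introenumerable A,
        ~ introreducible A
      & ~ majorenumerable A].
Proof.
(* One generic meets all three families of requirements, indexed jointly by a program and a stem;
   the stem matters only for the third. *)
have [G _ GP] : exists2 G, freeze (0, fun=> false, 0) G &
    forall cs : code * seq nat,
    [/\ exists C, [/\ infinite_set C, C `<=` guesses G
                    & eoperator (dom cs.1) C <> guesses G],
        ~ forall x y, eval (pairs G G) cs.1 x y <-> y = (x \in guesses G)
      & guesses G <> forced_by_majorants cs.1 cs.2].
  apply: (@generic_exists bool _ freeze _ (fun cs : code * seq nat => [set G |
    [/\ exists C, [/\ infinite_set C, C `<=` guesses G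
                    & eoperator (dom cs.1) C <> guesses G],
        ~ forall x y, eval (pairs G G) cs.1 x y <-> y = (x \in guesses G)
      & guesses G <> forced_by_majorants cs.1 cs.2]])).
  - exact: freeze_nonempty.
  - move=> [[k X] N] G GP; split=> [i ik|n m nN km].
      by have [H [HX _] <-] := GP i.+1; rewrite ?HX.
    by have [H [_ HN] <-] := GP (npair n m).+1; rewrite ?HN.
  - move=> n [[k X] N]; have [G GP] := freeze_nonempty (k, X, N).
    exists (maxn k n.+1, G, N).
      by apply: (freeze_extend GP) => //; exact: leq_maxl.
    by exists (G n) => H [/= -> //]; exact: leq_maxr.
  - move=> [c s] p /=; have [q qp qP] := dense_not_uniform c p.
    have [r rq rP] := dense_not_introreducible c q.
    have [t tr tP] := dense_neq (forced_by_majorants c s) r.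
    exists t; first exact: subset_trans (subset_trans tr rq) qp.
    by move=> G Gt; split; [exact/qP/rq/tr|exact/rP/tr|exact: tP].
exists (guesses G); split; first exact: guesses_introenumerable.
- move=> [_ [Theta [[c ->] cP]]]; have [[C [Cinf CA nE]] _ _] := GP (c, [::]).
  exact: nE (cP C Cinf CA).
- move=> [_ /(_ (pairs G G))[||c cP]]; [exact: pairs_infinite|exact: pairs_subl|].
  by have [_ + _] := GP (c, [::]); apply.
- by apply: not_majorenumerable => c s; have [_ _] := GP (c, s).
Qed.
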